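(* Let $G$ be a connected ribbon graph with $|E(G)|=m$ and let $k$ be an even positive integer. Then every $k$-regular checkerboard colourable twisted dual of $G$ can be written in the form $G^{\tau(A_1)\delta(A_2)\tau(A_3)}$, where (1) $A_1\subseteq E(G)$; (2) $A_2=E(Q)\,\Delta\,\{e_1,\dots,e_n\}$, where $Q$ is a spanning quasi-tree of $G^{\tau(A_1)}$, $n=\frac{2m}{k}-1$, $\{C_1,\dots,C_n\}$ is a shorter marking arrow sequence set of the bouquet $G^{\tau(A_1)\delta(E(Q))}$ with $d(C_i)=k$ for all $i$, and $e_i$ is the edge corresponding to $C_i$; (3) $A_3=A_0\,\Delta\,E_{f_1}\,\Delta\cdots\Delta\,E_{f_s}$, where $T$ is a spanning tree of $G^{\tau(A_1)\delta(A_2)}$, $A_0=\{e\in E(G)\setminus E(T)\mid t(e,G^{\tau(A_1)\delta(A_2)}/E(T))=1\}$, $A_3\cap E(T)=\{f_1,\dots,f_s\}$, and $E_{f_j}$ is the adjoint set of $f_j$ in $G^{\tau(A_1)\delta(A_2)}$ with respect to $T$.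
   Context: A ribbon graph is a (possibly non-orientable) surface with boundary written as a union of vertex discs and edge discs meeting in disjoint line segments (common line segments), each lying on exactly one vertex and one edge, each edge containing exactly two. Edge line segments: the two boundary arcs of an edge disc other than its common line segments; vertex line segments: boundary arcs of a vertex disc other than common line segments. Degree of a vertex: number of common line segments on it; $k$-regular: all degrees equal $k$. Checkerboard colourable: boundary components can be coloured black/white so that the two edge line segments of each edge get different colours. Bouquet: one vertex. Quasi-tree: exactly one boundary component; a spanning quasi-tree of $H$ is a spanning ribbon subgraph (all vertices, edge set $E(Q)$) that is a quasi-tree. Arrow presentation: circles (vertex boundaries) with, for each edge $e$, two marking arrows labelled $e$ on its common line segments; the ribbon graph is recovered by filling circles with discs and attaching an edge disc along the two $e$-arrows so that their directions agree. Partial Petrial $H^{\tau(A)}$: reverse one of the two arrows of each $e\in A$. Partial dual $H^{\delta(A)}$: for $e\in A$ with arrows $e',e''$, draw segments directed from head of $e'$ to tail of $e''$ and from head of $e''$ to tail of $e'$, both labelled $e$, and delete the arcs carrying $e',e''$. $H/A=H^{\delta(A)}-A$. Edges are identified across operations; $H^{\tau(A)\delta(B)\tau(C)}$ means apply $\tau(A)$, then $\delta(B)$, then $\tau(C)$. Two ribbon graphs $G,H$ are twisted duals if $H=G^{1(A_1)\delta(A_2)\tau(A_3)\tau\delta(A_4)\delta\tau(A_5)\tau\delta\tau(A_6)}$ for a partition $A_1,\dots,A_6$ of $E(G)$, where $1$ is the identity and for a word $w_1\cdots w_r$ in $\delta,\tau$, $G^{w_1\cdots w_r(A)}$ means applying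 $w_1(A)$ first, then $w_2(A)$, etc. Shorter marking arrow sequences: for a bouquet with $m$ edges, read the $2m$ arrows on its circle $C$ in a fixed cyclic order. For an edge $e$, the arc from the first $e$-arrow up to (excluding) the second, and the arc from the second up to (excluding) the first, partition the arrows; a shorter marking arrow sequence of $e$ is the one with fewer arrows (either if equal), and $e$ is its corresponding edge; one is fixed per edge. A set $\{C_1,\dots,C_n\}$ of these is a shorter marking arrow sequence set if each corresponding edge is an orientable loop (vertex plus that edge is orientable) and any two $C_i,C_j$ (as sets of arrow positions) are nested or disjoint; the empty set qualifies. $d(C_k)$ = number of arrows in $C_k\setminus\bigcup_{i\neq k}C_i$. Index and adjoint sets, for a ribbon graph $H$ with spanning tree $T$: for $e\notin E(T)$ with arrows $e',e''$ on the circle of the bouquet $H/E(T)$, $t(e,H/E(T))=0$ if the number of vertex line segments from the one at the head of $e'$ to the one at the tail of $e''$ (inclusive) along the circle is odd, and $1$ otherwise. For $f\in E(T)$, the two arrows of $f$ on the circle of the bouquet $H^{\delta(E(T))}$ cut it into two arcs; pick one, $P_f$; the adjoint set is $E_f=\{f\}\cup\{g\in E(H)\setminus E(T)\mid\text{exactly one arrow of } g \text{ lies on } P_f\}$.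
   Formalization: d(C_k) is taken as the number of arrows in C_k outside the C_i properly contained in C_k, not outside all C_i with i≠k; with the latter any nested inner C_i has d=0 and the claim fails, e.g. for the plane 4-cycle with k=2. *)

(* Defs.v *)
From HB Require Import structures.
From mathcomp Require Import all_boot.

Set Implicit Arguments.
Unset Strict Implicit.
Unset Printing Implicit Defensive.

(* A ribbon graph with edge set E is encoded by an arrow presentation.  Each
   edge e carries two marking arrows (e, false) and (e, true); an arrow a has
   the two end points (a, true), its head, and (a, false), its tail.  The arcs
   of the circles between consecutive arrows (the vertex line segments) form a
   perfect matching of the end points, the fixed-point-free involution vline.
   The circles are the cycles formed by the arrows and these arcs, together
   with "bare" circles that carry no arrow (isolated vertices).  Circles are
   not oriented.  *)

Notation arrow E := (E * bool)%type (only parsing).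
Notation point E := (E * bool * bool)%type (only parsing).

Record ribbon_graph (E : finType) := RibbonGraph {
  vline : point E -> point E;
  bare : nat;
  vlineK : involutive vline;
  vline_neq : forall p, vline p != p }.

Section Points.
Variable E : finType.
Implicit Type p : point E.

Definition edge p : E := p.1.1.

Definition flip_arrow (a : arrow E) : arrow E := (a.1, ~~ a.2).

(* the other end of the common line segment, resp. of the edge line segment,
   containing p; the boundary of an edge disc follows both of its arrows, so
   its edge line segments join the head of each arrow to the tail of the
   other one *)
Definition cline p : point E := (p.1, ~~ p.2).
Definition eline p : point E := (flip_arrow p.1, ~~ p.2).

Lemma clineK : involutive cline.
Proof. by move=> [[e b] h]; rewrite /cline /= negbK. Qed.

End Points.

Section Renaming.
Variables (E : finType) (f g : point E -> point E).
Hypotheses (fK : cancel f g) (gK : cancel g f).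
Variable H : ribbon_graph E.

(* the ribbon graph on the same circles, in which the point called p was
   called f p in H *)
Definition rename : ribbon_graph E.
Proof.
refine (@RibbonGraph E (fun p => g (vline H (f p))) (bare H) _ _).
- by move=> p; rewrite gK vlineK fK.
- by move=> p; rewrite -(inj_eq (can_inj fK)) gK vline_neq.
Defined.

End Renaming.

Inductive operation := Delta | Tau.

Section Operations.
Variable E : finType.
Implicit Types (A : {set E}) (H : ribbon_graph E).

(* partial Petrial: the arrow (e, true) is reversed for every e in A *)
Definition petrial_point A (p : point E) : point E :=
  if (edge p \in A) && p.1.2 then cline p else p.

Lemma petrial_pointK A : involutive (petrial_point A).
Proof.
move=> [[e b] h]; rewrite /petrial_point /edge /cline /=.
by case eA: (e \in A); case: b; rewrite /= ?eA //= ?negbK.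
Qed.

Definition petrial A H : ribbon_graph E :=
  rename (@petrial_pointK A) (@petrial_pointK A) H.

(* partial dual: for e in A, the new arrow (e, b) goes from the head of the
   old arrow (e, b) to the tail of the old arrow (e, ~~ b); pdual_old maps the
   new name of an end point to its old name *)
Definition pdual_old A (p : point E) : point E :=
  if edge p \in A then
    if p.2 then (flip_arrow p.1, false) else (p.1, true)
  else p.

Definition pdual_new A (p : point E) : point E :=
  if edge p \in A then
    if p.2 then (p.1, false) else (flip_arrow p.1, true)
  else p.

Lemma pdual_oldK A : cancel (pdual_old A) (pdual_new A).
Proof.
move=> [[e b] h]; rewrite /pdual_old /pdual_new /edge /=.
by case eA: (e \in A); case: h; rewrite /= ?eA //= /flip_arrow /= negbK.
Qed.

Lemma pdual_newK A : cancel (pdual_new A) (pdual_old A).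
Proof.
move=> [[e b] h]; rewrite /pdual_old /pdual_new /edge /=.
by case eA: (e \in A); case: h; rewrite /= ?eA //= /flip_arrow /= negbK.
Qed.

Definition pdual A H : ribbon_graph E :=
  rename (@pdual_oldK A) (@pdual_newK A) H.

(* Equality of ribbon graphs with the same edge labels: an arrow presentation
   determines its ribbon graph up to exchanging the names of the two arrows of
   an edge, and reversing both arrows of an edge.  *)
Definition relabel (s r : E -> bool) (p : point E) : point E :=
  ((edge p, p.1.2 (+) s (edge p)), p.2 (+) r (edge p)).

Definition same_ribbon_graph H H' : Prop :=
  bare H = bare H' /\
  exists s r : E -> bool,
    forall p, vline H' (relabel s r p) = relabel s r (vline H p).

(* words act from left to right *)
Definition twist (w : seq operation) A H : ribbon_graph E :=
  foldl (fun K o => if o is Tau then petrial A K else pdual A K) H w.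

Definition twisted_dual G H : Prop :=
  exists A1 A2 A3 A4 A5 A6 : {set E},
    [/\ A1 :|: A2 :|: A3 :|: A4 :|: A5 :|: A6 = [set: E],
        pairwise (fun A B => [disjoint A & B]) [:: A1; A2; A3; A4; A5; A6] &
        same_ribbon_graph H
          (twist [:: Tau; Delta; Tau] A6 (twist [:: Delta; Tau] A5
            (twist [:: Tau; Delta] A4 (twist [:: Tau] A3
              (twist [:: Delta] A2 (twist [::] A1 G))))))].

End Operations.

Section Graphs.
Variable E : finType.
Implicit Types (H : ribbon_graph E) (D T : {set E}) (a b : arrow E)
  (p q : point E).

(* A spanning ribbon subgraph of H is determined by its edge set D; the arrows
   of the edges outside D are then plain parts of the circles.  *)

Definition circle_rel H : rel (point E) :=
  fun p q => (q == vline H p) || (q == cline p).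

Definition boundary_rel H D : rel (point E) :=
  fun p q => (q == vline H p) ||
             (q == if edge p \in D then eline p else cline p).

Definition connect_rel H D : rel (point E) :=
  fun p q => circle_rel H p q || (edge p \in D) && (q == eline p).

Definition nb_vertices H : nat :=
  n_comp (circle_rel H) {: point E} + bare H.

Definition nb_boundary H D : nat :=
  n_comp (boundary_rel H D) {: point E} + bare H.

Definition nb_components H D : nat :=
  n_comp (connect_rel H D) {: point E} + bare H.

Definition connected_on H D : bool := nb_components H D == 1.

Definition connected H : bool := connected_on H [set: E].

Definition bouquet H : bool := nb_vertices H == 1.

Definition quasi_tree H D : bool := nb_boundary H D == 1.

Definition same_circle H a b : bool :=
  connect (circle_rel H) (a, true) (b, true).

(* degree of the vertex carrying the arrow a *)
Definition degree H a : nat := #|[set b | same_circle H a b]|.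

Definition regular k H : Prop :=
  (forall a, degree H a = k) /\ (0 < bare H -> k = 0).

(* a cycle is a nonempty closed walk with distinct edges, given by the arrows
   along which it leaves the successive vertices *)
Definition acyclic H D : Prop :=
  forall s : seq (arrow E),
    uniq [seq a.1 | a <- s] -> {in s, forall a, a.1 \in D} ->
    cycle (fun a b => same_circle H (flip_arrow a) b) s -> s = [::].

Definition spanning_tree H T : Prop := connected_on H T /\ acyclic H T.

(* c is constant on boundary components; cline exchanges the two edge line
   segments of an edge *)
Definition checkerboard_colourable H : Prop :=
  exists c : point E -> bool,
    (forall p q, connect (boundary_rel H [set: E]) p q -> c p = c q) /\
    (forall p, c (cline p) != c p).

(* Orient all vertex discs, and let c p tell whether p is the initial point of
   its common line segment.  The edge discs of D can be oriented compatibly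
   (with opposite orientations on each common line segment) if and only if
   their edge line segments join initial points to final points.  *)
Definition orientable H D : Prop :=
  exists c : point E -> bool,
    [/\ forall p, c (vline H p) != c p,
        forall p, c (cline p) != c p &
        forall p, edge p \in D -> c (eline p) != c p].

End Graphs.

Section Sequences.
Variable E : finType.
Implicit Types (B : ribbon_graph E) (w : seq (arrow E)).

(* from the point where an arrow is entered to the point where the next arrow
   of the circle is entered *)
Definition next_entry B (p : point E) : point E := vline B (cline p).

(* w lists the arrows of the bouquet B in one of the two cyclic orders *)
Definition reading B w : Prop :=
  exists2 o : seq (point E), fcycle (next_entry B) o &
    w = [seq p.1 | p <- o] /\ perm_eq w (enum {: arrow E}).

Definition shorter_sequence w (e : E) (C : {set arrow E}) : Prop :=
  exists b : bool,
    let P := arc w (e, b) (e, ~~ b) in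
    let P' := arc w (e, ~~ b) (e, b) in
    size P <= size P' /\ C = [set a in P].

(* a fixed cyclic order, and one shorter marking arrow sequence per edge *)
Definition shorter_sequences B (C : E -> {set arrow E}) : Prop :=
  exists2 w, reading B w & forall e, shorter_sequence w e (C e).

(* the set of the sequences C e, for e in S *)
Definition shorter_sequence_set B (C : E -> {set arrow E}) (S : {set E}) :
    Prop :=
  (forall e, e \in S -> orientable B [set e]) /\
  (forall e f, e \in S -> f \in S ->
     [\/ C e \subset C f, C f \subset C e | [disjoint C e & C f]]).

(* Only the sequences nested inside C e are removed: removing also those that
   contain C e would give 0 for every inner sequence.  *)
Definition seq_degree (C : E -> {set arrow E}) (S : {set E}) (e : E) : nat :=
  #|C e :\: \bigcup_(f in S | C f \proper C e) C f|.

End Sequences.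

Section SymmetricDifference.
Variable E : finType.

Definition symdiff (A B : {set E}) : {set E} := (A :\: B) :|: (B :\: A).

Lemma in_symdiff A B x : (x \in symdiff A B) = (x \in A) (+) (x \in B).
Proof. by rewrite !inE; case: (x \in A); case: (x \in B). Qed.

Lemma symdiffA : associative symdiff.
Proof. by move=> A B C; apply/setP=> x; rewrite !in_symdiff addbA. Qed.

Lemma symdiffC : commutative symdiff.
Proof. by move=> A B; apply/setP=> x; rewrite !in_symdiff addbC. Qed.

Lemma sym0diff : left_id set0 symdiff.
Proof. by move=> A; apply/setP=> x; rewrite in_symdiff inE. Qed.

HB.instance Definition _ :=
  Monoid.isComLaw.Build {set E} set0 symdiff symdiffA symdiffC sym0diff.

End SymmetricDifference.

Section SpanningTree.
Variable E : finType.
Implicit Types (H B : ribbon_graph E) (D T : {set E}) (p q : point E).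

(* from the point where an arrow is left to the point where the next arrow of
   the circle is left *)
Definition next_exit B p : point E := cline (vline B p).

(* Number of vertex line segments of the bouquet with edge set D (on the circle
   of B), from the one at p to the one at q, along the circle starting away
   from the arrow of p.  The walk goes through the vertex line segments
   {r, vline B r} of B until it meets q; two successive ones belong to
   different vertex line segments of the subgraph if and only if the arrow
   between them has its edge in D.  *)
Definition nb_vlines B D p q : nat :=
  let o := orbit (next_exit B) p in
  let i := find (fun r => (r == q) || (vline B r == q)) o in
  (count (fun r => edge r \in D) (take i (behead o))).+1.

(* t(e, -) for the bouquet with edge set D on the circle of B *)
Definition tindex B D (e : E) : nat :=
  if odd (nb_vlines B D ((e, false), true) ((e, true), false)) then 0 else 1.

(* t(e, H / T), where H / T = pdual T H - T *)
Definition contraction_tindex H T (e : E) : nat := tindex (pdual T H) (~: T) e.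

Definition tindex1_set H T : {set E} :=
  [set e | (e \notin T) && (contraction_tindex H T e == 1)].

(* the adjoint set of f; P is the arc of the circle of pdual T H that starts
   with the arrow (f, false), traversed forwards, and ends before (f, true) *)
Definition adjoint_set H T (f : E) : {set E} :=
  let w := [seq p.1 | p <- orbit (next_entry (pdual T H)) ((f, false), false)] in
  let P := arc w (f, false) (f, true) in
  f |: [set g | (g \notin T) && (((g, false) \in P) (+) ((g, true) \in P))].

End SpanningTree.

(* Main.v *)
(* An edge of a ribbon graph has four points, on which the common line segments,
   the edge line segments and the two diagonals form the three perfect
   matchings; duals and Petrials permute these matchings and keep the vertex
   line segments.  Every word in delta and tau acts on the matchings of an edge
   as tau^a delta^b tau^c, which gives A_1, A_2 and A_3.

   Take any spanning tree T of H_1 = G^{tau(A_1) delta(A_2)}.  For f in T, the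
   points lie on two sides of f, according to the component of T - f.  On the
   circle of H_1^{delta(T)} the side changes exactly where the circle crosses an
   arrow of f.  Hence that circle is unique, so T is a spanning quasi-tree and
   Q = A_2 + T is one of G^{tau(A_1)}; the arc between the two f-arrows is one
   side of f; and two points lie on the same vertex of H_1 if and only if they
   lie on the same side of every edge of T.  This shows that the arcs are
   laminar and that each region between them is a vertex, of degree k.

   A checkerboard colouring c of H changes along a common line segment, and
   along an edge line segment of H_1 exactly at the edges of A_3.  Adding to c
   the sides of all f in A_3 and T gives a function that changes along the
   circle exactly at the arrows outside T; this is the formula for A_3. *)

Require Import Defs.
From mathcomp Require Import all_boot zify.

Set Implicit Arguments.
Unset Strict Implicit.
Unset Printing Implicit Defensive.

Section Connect.
Variables (T T' : finType).

Lemma connect_ind (r : rel T) (P : T -> Prop) x y :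
  (forall u v, r u v -> P u -> P v) -> connect r x y -> P x -> P y.
Proof.
move=> rP /connectP[s]; elim: s x => [|z s IH] x /=; first by move=> _ ->.
by case/andP=> /rP xz sP yE /xz; apply: IH.
Qed.

Lemma connect_homo (f : T -> T') (r : rel T) (r' : rel T') x y :
  (forall u v, r u v -> connect r' (f u) (f v)) ->
  connect r x y -> connect r' (f x) (f y).
Proof.
move=> rr' xy; apply: (connect_ind (P := fun z => connect r' (f x) (f z))) xy _.
  by move=> u v /rr' uv xu; apply: connect_trans uv.
exact: connect0.
Qed.

Lemma n_comp1P (r : rel T) (x0 : T) : symmetric r ->
  reflect (forall x y, connect r x y) (n_comp r {: T} == 1).
Proof.
move=> /sym_connect_sym r_sym; apply: (iffP idP) => [/eqP n1 x y | conn].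
  rewrite -root_connect //; apply/eqP.
  case/mem_card1: n1 => z zP.
  have root_z u : root r u = z.
    by have := zP (root r u); rewrite !inE roots_root // => /esym/eqP.
  by rewrite !root_z.
rewrite -(n_comp_connect r_sym x0); apply/eqP/eq_n_comp_r => y.
by rewrite !inE conn.
Qed.

Lemma n_comp_gt0 (r : rel T) (x0 : T) : symmetric r -> 0 < n_comp r {: T}.
Proof.
move=> /sym_connect_sym r_sym; apply/card_gt0P; exists (root r x0).
by rewrite !inE roots_root.
Qed.

End Connect.

Lemma connect_bij (T T' : finType) (f : T -> T') (g : T' -> T)
    (r : rel T) (r' : rel T') :
  cancel f g -> cancel g f -> (forall x y, r' (f x) (f y) = r x y) ->
  forall x y, connect r' (f x) (f y) = connect r x y.
Proof.
move=> fK gK rr' x y; apply/idP/idP.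
  rewrite -{2}(fK x) -{2}(fK y); apply: connect_homo => u v uv.
  by apply: connect1; rewrite -rr' !gK.
by apply: connect_homo => u v uv; apply: connect1; rewrite rr'.
Qed.

Section Points.
Variable E : finType.
Implicit Types (p q : point E) (H B K : ribbon_graph E) (D T : {set E}).

Lemma elineK : involutive (@eline E).
Proof. by move=> [[e b] h]; rewrite /eline /flip_arrow /= !negbK. Qed.

Lemma cline_neq p : cline p != p.
Proof. by case: p => [[e []] []]; rewrite /cline !xpair_eqE /= ?andbF. Qed.

Lemma cline_eline p : cline (eline p) = eline (cline p).
Proof. by []. Qed.

Lemma edge_cline p : edge (cline p) = edge p. Proof. by []. Qed.

Lemma edge_eline p : edge (eline p) = edge p. Proof. by []. Qed.

Lemma same_edge p q : edge p = edge q ->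
  [\/ q = p, q = cline p, q = eline p | q = cline (eline p)].
Proof.
case: p q => [[e b] h] [[e' b'] h']; rewrite /edge /= => <-.
case: b b' h h' => [] [] [] []; by [constructor 1 | constructor 2 |
  constructor 3 | constructor 4].
Qed.

Lemma same_arrow p q : p.1 = q.1 -> q = p \/ q = cline p.
Proof.
by case: p q => [a []] [a' []] /= ->; rewrite /cline /=; [left|right|right|left].
Qed.

Lemma vline_inj H : injective (vline H).
Proof. exact: inv_inj (@vlineK _ H). Qed.

Lemma circle_sym H : symmetric (circle_rel H).
Proof.
move=> p q; rewrite /circle_rel; congr (_ || _).
  by apply/eqP/eqP => ->; rewrite vlineK.
by apply/eqP/eqP => ->; rewrite clineK.
Qed.

Lemma boundary_sym H D : symmetric (boundary_rel H D).
Proof.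
move=> p q; rewrite /boundary_rel; congr (_ || _).
  by apply/eqP/eqP => ->; rewrite vlineK.
pose x r := if edge r \in D then eline r else cline r.
have xK : involutive x.
  move=> r; rewrite /x; case rD: (edge r \in D).
    by rewrite edge_eline rD elineK.
  by rewrite edge_cline rD clineK.
by rewrite -/(x p) -/(x q) eq_sym (can2_eq xK xK).
Qed.

Lemma connect_rel_sym H D : symmetric (connect_rel H D).
Proof.
move=> p q; rewrite /connect_rel circle_sym; congr (_ || _).
by apply/andP/andP=> -[pD /eqP ->]; rewrite ?edge_eline elineK.
Qed.

Lemma circle_vline H p : connect (circle_rel H) p (vline H p).
Proof. by apply: connect1; rewrite /circle_rel eqxx. Qed.

Lemma circle_cline H p : connect (circle_rel H) p (cline p).
Proof. by apply: connect1; rewrite /circle_rel eqxx orbT. Qed.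

Lemma circle_connect_sym H : connect_sym (circle_rel H).
Proof. exact/sym_connect_sym/circle_sym. Qed.

Lemma connect_vline H D p : connect (connect_rel H D) p (vline H p).
Proof. by apply: connect1; rewrite /connect_rel /circle_rel eqxx. Qed.

Lemma connect_cline H D p : connect (connect_rel H D) p (cline p).
Proof. by apply: connect1; rewrite /connect_rel /circle_rel eqxx !orbT. Qed.

Lemma connect_eline H D p : edge p \in D ->
  connect (connect_rel H D) p (eline p).
Proof. by move=> pD; apply: connect1; rewrite /connect_rel pD eqxx !orbT. Qed.

Lemma connect_edge H D p q : edge p \in D -> edge p = edge q ->
  connect (connect_rel H D) p q.
Proof.
move=> pD /same_edge[] ->; rewrite ?connect0 ?connect_cline ?connect_eline //.
exact: connect_trans (connect_eline _ pD) (connect_cline _ _ _).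
Qed.

Lemma connect_rel_ind H D (P : point E -> Prop) p q :
  (forall x, P x -> P (vline H x)) -> (forall x, P x -> P (cline x)) ->
  (forall x, edge x \in D -> P x -> P (eline x)) ->
  connect (connect_rel H D) p q -> P p -> P q.
Proof.
move=> Pv Pc Pe; apply: connect_ind => u v.
by case/orP=> [/orP[]|/andP[uD]] /eqP ->; auto.
Qed.

Lemma circle_ind H (P : point E -> Prop) p q :
  (forall x, P x -> P (vline H x)) -> (forall x, P x -> P (cline x)) ->
  connect (circle_rel H) p q -> P p -> P q.
Proof.
by move=> Pv Pc; apply: connect_ind => u v /orP[] /eqP ->; auto.
Qed.

End Points.

Section Counts.
Variables (E : finType) (e0 : E).
Implicit Types (H : ribbon_graph E) (D : {set E}).

Let p0 : point E := (e0, true, true).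

Lemma comps_bareP (r : rel (point E)) n : symmetric r ->
  reflect ((forall x y, connect r x y) /\ n = 0)
    (n_comp r {: point E} + n == 1).
Proof.
move=> r_sym; apply: (iffP idP) => [|[/(n_comp1P p0 r_sym)/eqP -> ->] //].
have := n_comp_gt0 p0 r_sym => n_gt0 n1.
have n_eq0 : n = 0 by move: n_gt0 n1; case: (n_comp r _) => [|[|c]] //; case: (n).
split=> //; apply/(n_comp1P p0 r_sym); by rewrite n_eq0 addn0 in n1.
Qed.

Lemma bouquetP H :
  reflect ((forall x y, connect (circle_rel H) x y) /\ bare H = 0) (bouquet H).
Proof. exact: comps_bareP (circle_sym H). Qed.

Lemma quasi_treeP H D :
  reflect ((forall x y, connect (boundary_rel H D) x y) /\ bare H = 0)
    (quasi_tree H D).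
Proof. exact: comps_bareP (boundary_sym H D). Qed.

Lemma connected_onP H D :
  reflect ((forall x y, connect (connect_rel H D) x y) /\ bare H = 0)
    (connected_on H D).
Proof. exact: comps_bareP (connect_rel_sym H D). Qed.

End Counts.

Lemma involution_even (T : finType) (i : T -> T) (A : {set T}) :
  involutive i -> (forall x, i x != x) -> (forall x, x \in A -> i x \in A) ->
  ~~ odd #|A|.
Proof.
move=> iK i_neq; have [n] := ubnP #|A|; elim: n A => // n IH A An Ai.
have [->|[x xA]] := set_0Vmem A; first by rewrite cards0.
have ixA : i x \in A :\ x by rewrite !inE i_neq Ai.
move: An; rewrite (cardsD1 x A) xA (cardsD1 (i x) (A :\ x)) ixA !add1n /=.
rewrite negbK => An; apply: IH => [|y]; first exact: leq_trans (leqnSn _) An.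
rewrite !inE (can2_eq iK iK) => /and3P[y1 y2 yA].
by rewrite (inv_eq iK) iK y1 y2 Ai.
Qed.

Section Cuts.
Variables (E : finType) (e0 : E) (H : ribbon_graph E).
Implicit Types (p q x y : point E) (D U : {set E}).

(* [side f] tells the two components of the spanning tree [T] minus [f] apart. *)
Record cuts (T : {set E}) (side : E -> point E -> bool) : Prop := Cuts {
  cut_v : forall f p, f \in T -> side f (vline H p) = side f p;
  cut_c : forall f p, f \in T -> side f (cline p) = side f p;
  cut_e : forall f p, f \in T -> edge p \in T ->
    side f (eline p) = side f p (+) (edge p == f) }.

Lemma connected_cuts : connected H ->
  exists T side, connected_on H T /\ cuts T side.
Proof.
move=> Hconn; have [T /minsetP[connT minT] _] := minset_exists Hconn.
have [Tconn bare0] := connected_onP e0 H T connT.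
pose side f := connect (connect_rel H (T :\ f)) (f, false, true).
exists T, side; split=> //.
have closed f : {homo side f : x y / connect (connect_rel H (T :\ f)) x y >->
    x -> y}.
  by move=> x y xy sx; apply: connect_trans xy.
have side_eq f x y : connect (connect_rel H (T :\ f)) x y -> side f x = side f y.
  by move=> xy; rewrite /side (same_connect_r (sym_connect_sym _) xy) //;
     apply: connect_rel_sym.
split=> [f p fT|f p fT|f p fT pT].
- by apply/esym/side_eq/connect_vline.
- by apply/esym/side_eq/connect_cline.
have [pf|pf] := eqVneq (edge p) f; last first.
  by rewrite addbF; apply/esym/side_eq/connect_eline; rewrite !inE pf.
have not_both : ~ (side f (f, false, true) /\ side f (eline (f, false, true))).
  case=> s1 s2.
  have sideT q : edge q = f -> side f q.
    case/esym/(@same_edge _ (f, false, true)) => -> //.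
      exact: closed (connect_cline _ _ _) _.
    exact: closed (connect_cline _ _ _) _.
  have conn' : connected_on H (T :\ f).
    apply/(connected_onP e0); split=> // x y.
    apply: (connect_rel_ind (P := connect (connect_rel H (T :\ f)) x))
      (Tconn x y) (connect0 _ _) => [z xz|z xz|z zT xz].
    - exact: connect_trans xz (connect_vline _ _ _).
    - exact: connect_trans xz (connect_cline _ _ _).
    have [zf|zf] := eqVneq (edge z) f; last first.
      by apply: connect_trans xz (connect_eline _ _); rewrite !inE zf.
    apply: connect_trans xz _; apply: (connect_trans (y := (f, false, true))).
      by rewrite (sym_connect_sym (connect_rel_sym _ _)); apply: sideT.
    by apply: sideT; rewrite edge_eline.
  by have := minT _ conn' (subsetDl _ _) => /setP/(_ f); rewrite !inE eqxx fT.
have s0 : side f (f, false, true) by apply: connect0.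
have s1 : side f (eline (f, false, true)) = false.
  by apply/negP => s1; apply: not_both.
have sc q : side f (cline q) = side f q by apply/esym/side_eq/connect_cline.
case/esym/(@same_edge _ (f, false, true)): pf => ->.
- by rewrite s0 s1.
- by rewrite -cline_eline !sc s0 s1.
- by rewrite elineK s0 s1.
by rewrite -cline_eline elineK !sc s0 s1.
Qed.

Variables (T : {set E}) (side : E -> point E -> bool).
Hypothesis cutT : cuts T side.

Lemma cuts_circle f x y : f \in T -> connect (circle_rel H) x y ->
  side f x = side f y.
Proof.
move=> fT xy; apply: (circle_ind (P := fun z => side f x = side f z)) xy _ => //.
  by move=> z ->; rewrite (cut_v cutT).
by move=> z ->; rewrite (cut_c cutT).
Qed.

Lemma cuts_acyclic : acyclic H T.
Proof.
case=> // a s; set f := a.1 => s_uniq sT s_cycle; exfalso.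
have fT : f \in T by apply: sT; rewrite mem_head.
pose g (b : arrow E) := side f (b, true).
have step b b' : b.1 \in T -> same_circle H (flip_arrow b) b' ->
    g b' = g b (+) (b.1 == f).
  move=> bT /(cuts_circle fT); rewrite /g => <-.
  rewrite -[RHS](cut_e cutT) // -[RHS](cut_c cutT) //.
have walk l b : path (fun a b => same_circle H (flip_arrow a) b) b (rcons l a) ->
    {in b :: l, forall c, c.1 \in T} ->
    g a = g b (+) odd (count (fun c => c.1 == f) (b :: l)).
  elim: l b => [|c l IH] b /=.
    by rewrite andbT => ba bT; rewrite (step b) ?bT ?mem_head // addn0 oddb.
  case/andP=> bc cl bT; rewrite (IH c) //; last first.
    by move=> d dl; apply: bT; rewrite inE dl orbT.
  by rewrite (step b) ?bT ?mem_head // (oddD (b.1 == f)) oddb addbA.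
move: (walk s a s_cycle sT).
rewrite -(count_map fst (pred1 f)) count_uniq_mem //= inE eqxx.
by case: (g a).
Qed.

Lemma cuts_vertex x y : connect (connect_rel H T) x y ->
  (forall f, f \in T -> side f x = side f y) -> connect (circle_rel H) x y.
Proof.
move=> xy sxy; have: T \subset T by [].
move: {1 2}T xy => U; have [n] := ubnP #|U|; elim: n U => // n IH U Un xy UT.
have [U0|[f fU]] := set_0Vmem U.
  apply: connect_sub xy => p q /orP[/connect1 //|].
  by rewrite U0 inE.
have fT : f \in T by apply: (subsetP UT).
apply: (IH (U :\ f)); last 1 first.
- exact: subset_trans (subsetDl _ _) UT.
- by move: Un; rewrite (cardsD1 f U) fU.
pose con := connect (connect_rel H (U :\ f)).
have side_con p q : con p q -> side f p = side f q.
  move=> pq; apply: (connect_rel_ind (P := fun z => side f p = side f z)) pq _.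
  - by move=> z ->; rewrite (cut_v cutT).
  - by move=> z ->; rewrite (cut_c cutT).
  - move=> z; rewrite !inE => /andP[zf zU] ->.
    by rewrite (cut_e cutT) ?(subsetP UT) // (negPf zf) addbF.
  - by [].
(* a walk that leaves the side of x through f comes back through f *)
pose P z : Prop := if side f z == side f x then (con x z : Prop) else
  exists r, [/\ edge r = f, con x r & con (eline r) z].
suff: P y by rewrite /P -(sxy f fT) eqxx.
have P_con p q : con p q -> P p -> P q.
  move=> pq; rewrite /P -(side_con _ _ pq); case: ifP => _.
    by move=> xp; apply: connect_trans pq.
  by case=> r [rf xr rp]; exists r; split=> //; apply: connect_trans pq.
apply: (connect_rel_ind (P := P)) xy _ => [z|z|z zU|].
- exact/P_con/connect_vline.
- exact/P_con/connect_cline.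
- have [zf|zf] := eqVneq (edge z) f; last first.
    by apply/P_con/connect_eline; rewrite !inE zf.
  rewrite /P (cut_e cutT) ?(subsetP UT) // zf eqxx addbT.
  case: ifP => [/eqP sz|sz].
    rewrite -sz ifF; last by case: (side f z).
    by move=> xz; exists z; split=> //; apply: connect0.
  case=> r [rf xr rz]; rewrite ifT; last first.
    by move: sz; case: (side f z) (side f x) => [] [].
  have : side f r != side f z.
    by rewrite -(side_con _ _ xr) eq_sym sz.
  have : side f (eline r) = side f z by apply: side_con.
  rewrite (cut_e cutT) ?rf ?fT // eqxx.
  have sc := cut_c cutT _ fT; have se q := cut_e cutT fT (p := q).
  have : edge r = edge z by rewrite rf zf.
  case/same_edge=> -> _ s_neq.
  + by rewrite eqxx in s_neq.
  + by rewrite sc eqxx in s_neq.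
  + by rewrite elineK.
  by rewrite -cline_eline elineK; apply: connect_trans (connect_cline _ _ _).
by rewrite /P eqxx; apply: connect0.
Qed.

(* Otherwise a boundary component [X] would run along [f] only once, and thus
   switch [side f] only once. *)
Lemma cuts_boundary x y : (forall x y, connect (connect_rel H T) x y) ->
  connect (boundary_rel H T) x y.
Proof.
move=> conn; pose X := [set z | connect (boundary_rel H T) x z].
have Xr u v : boundary_rel H T u v -> u \in X -> v \in X.
  by rewrite !inE => uv xu; apply: connect_trans (connect1 uv).
have Xv u : u \in X -> vline H u \in X.
  by apply: Xr; rewrite /boundary_rel eqxx.
have XeT u : edge u \in T -> u \in X -> eline u \in X.
  by move=> uT; apply: Xr; rewrite /boundary_rel uT eqxx orbT.
have XcT u : edge u \notin T -> u \in X -> cline u \in X.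
  by move=> /negPf uT; apply: Xr; rewrite /boundary_rel uT eqxx orbT.
have xX : x \in X by rewrite inE.
suff: y \in X by rewrite inE.
clearbody X => {Xr}.
have Xc u : u \in X -> cline u \in X.
  move=> uX; have [uT|/XcT-> //] := boolP (edge u \in T).
  have [//|cuX] := boolP (cline u \in X).
  set f := edge u in uT; pose X1 := [set z in X | side f z].
  have X1_even : ~~ odd #|X1|.
    apply: (involution_even (vlineK H) (vline_neq H)) => z.
    by rewrite !inE (cut_v cutT) // => /andP[/Xv -> ->].
  have X2_even : ~~ odd #|X1 :\: [set z | edge z == f]|.
    pose i z : point E := if edge z \in T then eline z else cline z.
    apply: (@involution_even _ i) => [z|z|z].
    - rewrite /i; case zT: (edge z \in T).
        by rewrite edge_eline zT elineK.
      by rewrite edge_cline zT clineK.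
    - rewrite /i; case: ifP => _; last exact: cline_neq.
      by case: z => [[e []] h]; rewrite /eline /flip_arrow !xpair_eqE /= ?andbF.
    rewrite !in_setD ![_ \in X1]inE ![_ \in [set _ | _]]inE /i.
    case: ifP => [zT|/negbT zT] /and3P[zf zX sz].
      by rewrite edge_eline zf XeT // (cut_e cutT) // (negPf zf) addbF.
    by rewrite edge_cline zf XcT // (cut_c cutT).
  have euX : eline u \in X by apply: XeT.
  have ceuX : cline (eline u) \notin X.
    by apply: contra cuX => /XeT; rewrite -cline_eline elineK; apply.
  pose v := if side f u then u else eline u.
  have X1f : X1 :&: [set z | edge z == f] = [set v].
    apply/setP=> z; rewrite !inE.
    have svE : side f (eline u) = ~~ side f u.
      by rewrite (cut_e cutT) // eqxx addbT.
    have uev : (u == eline u) = false.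
      by apply/eqP => ue; move: svE; rewrite -ue; case: (side f u).
    apply/idP/eqP => [/andP[/andP[zX sz] /eqP/esym/same_edge]|->].
      case=> zE; move: zX sz; rewrite zE /v ?(negPf cuX) ?(negPf ceuX) //.
        by move=> _ ->.
      by rewrite svE => _; case: (side f u).
    rewrite /v; case: ifP => su; first by rewrite uX su eqxx.
    by rewrite euX svE su edge_eline eqxx.
  move: X1_even; rewrite -(cardsID [set z | edge z == f]) X1f cards1 oddD.
  by rewrite (negPf X2_even).
exact: (connect_rel_ind (P := fun z => z \in X) Xv Xc XeT (conn x y)).
Qed.

End Cuts.

(* The point [p] of [B] is the point [theta p] of [H], and [B] is the partial
   dual of [H] with respect to [T]. *)
Record dual_map (E : finType) (H B : ribbon_graph E) (T : {set E})
    (theta theta' : point E -> point E) : Prop := DualMap {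
  dualK : cancel theta theta';
  dualK' : cancel theta' theta;
  dual_v : forall p, vline H (theta p) = theta (vline B p);
  dual_edge : forall p, edge (theta p) = edge p;
  dual_c : forall p, theta (cline p) =
    if edge p \in T then eline (theta p) else cline (theta p);
  dual_e : forall p, theta (eline p) =
    if edge p \in T then cline (theta p) else eline (theta p) }.

Record chords (E : finType) (B : ribbon_graph E) (T : {set E})
    (t : E -> point E -> bool) : Prop := Chords {
  chord_v : forall f p, f \in T -> t f (vline B p) = t f p;
  chord_c : forall f p, f \in T -> t f (cline p) = t f p (+) (edge p == f);
  chord_e : forall f p, f \in T -> edge p \in T -> t f (eline p) = t f p }.

Section Dual.
Variable E : finType.
Implicit Types (H B K : ribbon_graph E) (A T : {set E}) (p : point E).

Lemma edge_pdual_old A p : edge (pdual_old A p) = edge p.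
Proof. by rewrite /pdual_old; case: ifP => _ //; case: ifP. Qed.

Lemma edge_pdual_new A p : edge (pdual_new A p) = edge p.
Proof. by rewrite /pdual_new; case: ifP => _ //; case: ifP. Qed.

Lemma pdual_old_cline A p : pdual_old A (cline p) =
  if edge p \in A then eline (pdual_old A p) else cline (pdual_old A p).
Proof.
case: p => [[e b] h]; rewrite /pdual_old /cline /eline /flip_arrow /edge /=.
by case: ifP => _; case: h => //=; rewrite negbK.
Qed.

Lemma pdual_old_eline A p : pdual_old A (eline p) =
  if edge p \in A then cline (pdual_old A p) else eline (pdual_old A p).
Proof.
case: p => [[e b] h]; rewrite /pdual_old /cline /eline /flip_arrow /edge /=.
by case: ifP => _; case: h => //=; rewrite negbK.
Qed.

Lemma pdual_new_cline A p : pdual_new A (cline p) =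
  if edge p \in A then eline (pdual_new A p) else cline (pdual_new A p).
Proof.
case: p => [[e b] h]; rewrite /pdual_new /cline /eline /flip_arrow /edge /=.
by case: ifP => _; case: h => //=; rewrite negbK.
Qed.

Lemma pdual_new_eline A p : pdual_new A (eline p) =
  if edge p \in A then cline (pdual_new A p) else eline (pdual_new A p).
Proof.
case: p => [[e b] h]; rewrite /pdual_new /cline /eline /flip_arrow /edge /=.
by case: ifP => _; case: h => //=; rewrite negbK.
Qed.

Lemma dual_map_pdual T H :
  dual_map H (pdual T H) T (pdual_old T) (pdual_new T).
Proof.
split.
- exact: pdual_oldK.
- exact: pdual_newK.
- by move=> p; rewrite /= pdual_newK.
- exact: edge_pdual_old.
- exact: pdual_old_cline.
- exact: pdual_old_eline.
Qed.

Lemma dual_map_pdual2 A T K :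
  dual_map (pdual A K) (pdual (symdiff A T) K) T
    (pdual_new A \o pdual_old (symdiff A T))
    (pdual_new (symdiff A T) \o pdual_old A).
Proof.
set Q := symdiff A T; split=> p /=.
- by rewrite pdual_newK pdual_oldK.
- by rewrite pdual_newK pdual_oldK.
- by rewrite !pdual_newK.
- by rewrite edge_pdual_new edge_pdual_old.
- rewrite pdual_old_cline in_symdiff.
  case: (boolP (edge p \in A)) (boolP (edge p \in T)) => pA [] pT /=;
    by rewrite ?pdual_new_cline ?pdual_new_eline edge_pdual_old ?pA // (negPf pA).
rewrite pdual_old_eline in_symdiff.
case: (boolP (edge p \in A)) (boolP (edge p \in T)) => pA [] pT /=;
  by rewrite ?pdual_new_cline ?pdual_new_eline edge_pdual_old ?pA // (negPf pA).
Qed.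

Lemma dual_map_chords H B T theta theta' side :
  dual_map H B T theta theta' -> cuts H T side ->
  chords B T (fun f => side f \o theta).
Proof.
move=> D cutT; split=> f p fT /=.
- by rewrite -(dual_v D) (cut_v cutT).
- rewrite (dual_c D); case: (boolP (edge p \in T)) => pT.
    by rewrite (cut_e cutT) ?(dual_edge D).
  rewrite (cut_c cutT) //; have [pf|_] := eqVneq (edge p) f; last by rewrite addbF.
  by rewrite pf fT in pT.
by move=> pT; rewrite (dual_e D) pT (cut_c cutT).
Qed.

Lemma dual_map_bouquet (e0 : E) H B T theta theta' :
  dual_map H B T theta theta' -> bare B = bare H ->
  bouquet B = quasi_tree H T.
Proof.
move=> D bareE.
have rel p q : boundary_rel H T (theta p) (theta q) = circle_rel B p q.
  rewrite /boundary_rel /circle_rel (dual_v D) (dual_edge D) -(dual_c D).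
  by rewrite !(can_eq (dualK D)).
have conn := connect_bij (dualK D) (dualK' D) rel.
apply/(bouquetP e0)/(quasi_treeP e0); rewrite bareE => -[c ->]; split=> // x y.
  by rewrite -(dualK' D x) -(dualK' D y) conn.
by rewrite -conn.
Qed.

End Dual.


Section Reading.
Variables (E : finType) (B : ribbon_graph E) (o : seq (point E)).
Hypothesis o_cycle : fcycle (next_entry B) o.
Hypothesis o_perm : perm_eq [seq p.1 | p <- o] (enum {: arrow E}).
Implicit Types (p q : point E).

Let w := [seq p.1 | p <- o].

Let w_uniq : uniq w. Proof. by rewrite (perm_uniq o_perm) enum_uniq. Qed.

Let mem_w a : a \in w. Proof. by rewrite (perm_mem o_perm) mem_enum. Qed.

Lemma entry_inj p q : p \in o -> q \in o -> p.1 = q.1 -> p = q.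
Proof.
move=> po qo pq; apply/eqP; rewrite -(nth_index p po) -(nth_index p qo).
rewrite nth_uniq ?index_mem ?(map_uniq w_uniq) //.
rewrite -(nth_uniq p.1 _ _ w_uniq) ?size_map ?index_mem //.
by rewrite !(nth_map p) ?index_mem // !nth_index // pq.
Qed.

Lemma entry_cline p : (cline p \in o) = (p \notin o).
Proof.
apply/idP/idP => [cpo|po].
  apply/negP => po; have := cline_neq p.
  by rewrite (entry_inj cpo po erefl) eqxx.
have /mapP[q qo /esym/same_arrow[] pq] := mem_w p.1.
  by rewrite pq qo in po.
by rewrite pq clineK.
Qed.

Lemma entry_next p : p \in o -> next_entry B p \in o.
Proof. by move=> po; rewrite (eqP (next_cycle o_cycle po)) mem_next. Qed.

Lemma entry_vline p : (vline B p \in o) = (p \notin o).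
Proof.
apply/idP/idP => [vpo|po].
  have := prev_cycle o_cycle vpo; rewrite /= /next_entry => /eqP/vline_inj <-.
  by rewrite entry_cline negbK mem_prev.
by rewrite -[p]clineK; apply: entry_next; rewrite entry_cline.
Qed.

Lemma arc_reading (a b : arrow E) : a != b ->
  [/\ uniq (arc w a b), a \in arc w a b, b \notin arc w a b &
      size (arc w a b) + size (arc w b a) = #|{: arrow E}|].
Proof.
move=> ab; have [i p1 p2 arc1 arc2 rotE] :=
  rot_to_arc w_uniq (mem_w a) (mem_w b) ab.
have: uniq (rot i w) by rewrite rot_uniq.
rewrite rotE -cat_cons cat_uniq arc1 arc2 => /and3P[-> no_common _].
split=> //; first by rewrite -arc1 mem_head.
  by apply: (hasPn no_common); rewrite -arc2 mem_head.
by rewrite -arc1 -arc2 -size_cat cat_cons -rotE size_rot (perm_size o_perm) -cardE.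
Qed.

Lemma toggle_arc f b (t : point E -> bool) :
  (forall p, t (vline B p) = t p) ->
  (forall p, t (cline p) = t p (+) (edge p == f)) ->
  exists s, forall p, p \in o ->
    (p.1 \in arc w (f, b) (f, ~~ b)) = t (cline p) (+) s.
Proof.
move=> tv tc.
have fb : (f, b) != (f, ~~ b) by rewrite xpair_eqE eqxx; case: (b).
have [i p1 p2 arc1 arc2 rotE] := rot_to_arc w_uniq (mem_w _) (mem_w _) fb.
have: fcycle (next_entry B) (rot i o) by rewrite rot_cycle.
have mem_o p : p \in o = (p \in rot i o) by rewrite mem_rot.
have: uniq (rot i w) by rewrite rot_uniq.
rewrite rotE -arc1; move: rotE; rewrite /w -map_rot.
case: (rot i o) mem_o => // x o1x mem_o [xE].
move/(congr1 (fun s => (take (size p1) s, drop (size p1) s))).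
rewrite take_size_cat // drop_size_cat // -map_take -map_drop.
case=> /esym p1E p2E; have o1xE := cat_take_drop (size p1) o1x.
rewrite -o1xE in mem_o *.
move: (take _ o1x) (drop _ o1x) p1E p2E mem_o {o1xE}.
move=> o1 [//|y o2] p1E [yE /esym p2E] mem_o.
rewrite -cat_cons cat_uniq => /and3P[/andP[x_o1 _] no_common /andP[y_o2 _]].
rewrite (cycle_path x) /= last_cat /= cat_path /= => /and3P[_ o1_path].
case/andP=> y_next o2_path.
have step z z' : next_entry B z = z' ->
    t (cline z') = t (cline z) (+) (edge z' == f).
  by move=> <-; rewrite tc tv.
have walk z l : fpath (next_entry B) z l -> {in l, forall p, edge p != f} ->
    {in z :: l, forall p, t (cline p) = t (cline z)}.
  elim: l z => [|z' l IH] z /=; first by move=> _ _ p; rewrite inE => /eqP->.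
  case/andP=> /eqP zz' lp l_f p; rewrite inE => /predU1P[-> //|pl].
  rewrite (IH z') // => [|q ql]; last by apply: l_f; rewrite inE ql orbT.
  by rewrite (step _ _ zz') (negPf (l_f _ (mem_head _ _))) addbF.
have edge_f p : edge p = f -> p.1 = x.1 \/ p.1 = y.1.
  rewrite xE yE; case: p => [[e c] h]; rewrite /edge /= => ->.
  by case: (b) c => [] []; [left | right | right | left].
have o1_f : {in o1, forall p, edge p != f}.
  move=> p po1; apply/eqP => /edge_f[] pE.
    by case/negP: x_o1; rewrite p1E -xE -pE map_f.
  case/hasP: no_common; exists (f, ~~ b); first exact: mem_head.
  by rewrite inE p1E -yE -pE map_f // orbT.
have o2_f : {in o2, forall p, edge p != f}.
  move=> p po2; apply/eqP => /edge_f[] pE.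
    case/hasP: no_common; exists p.1; last by rewrite pE xE mem_head.
    by rewrite inE p2E map_f ?orbT.
  by case/negP: y_o2; rewrite p2E -yE -pE map_f.
exists (~~ t (cline x)) => p; rewrite mem_o -cat_cons mem_cat => /orP[]po.
  have -> : p.1 \in (f, b) :: p1 by rewrite p1E -xE -map_cons map_f.
  by rewrite (walk x o1) //; case: (t _).
have -> : (p.1 \in (f, b) :: p1) = false.
  by apply: contraNF no_common => pp; apply/hasP; exists p.1 => //;
    rewrite p2E -yE -map_cons map_f.
rewrite (walk y o2) // -(eqP y_next) tc tv (walk x o1) ?mem_last //.
rewrite (eqP y_next); have -> : edge y == f by rewrite /edge yE.
by case: (t _).
Qed.

End Reading.

Section Orbit.
Variables (E : finType) (B : ribbon_graph E).
Hypothesis conn : forall x y, connect (circle_rel B) x y.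
Implicit Types (p q : point E).

Lemma next_entry_inj : injective (next_entry B).
Proof. by move=> p q /vline_inj/(can_inj (@clineK E)). Qed.

Lemma next_exit_inj : injective (next_exit B).
Proof. by move=> p q /(can_inj (@clineK E))/vline_inj. Qed.

(* A walk that came back reversed would have turned round at a fixed point of
   [vline B] or [cline]. *)
Lemma entry_no_reversal n p : iter n (next_entry B) p != cline p.
Proof.
have [m] := ubnP n; elim: m n p => // m IH [|[|n]] p nm /=.
- by rewrite eq_sym cline_neq.
- exact: vline_neq.
apply/eqP => pE; case/eqP: (IH n (next_entry B p) (ltnW nm)).
rewrite -iterSr; apply: next_entry_inj.
by rewrite iterS -iterS pE /next_entry clineK vlineK.
Qed.

Lemma orbit_entry p0 q : (q \in orbit (next_entry B) p0) ||
  (cline q \in orbit (next_entry B) p0).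
Proof.
apply: (circle_ind (P := fun z => (z \in orbit (next_entry B) p0) ||
  (cline z \in orbit (next_entry B) p0))) (conn p0 q) _; last first.
- by rewrite -fconnect_orbit connect0.
- by move=> z; rewrite clineK orbC.
move=> z /orP[]; rewrite -!fconnect_orbit => pz; apply/orP.
  right; apply: connect_trans pz _; rewrite fconnect_sym; last exact: next_entry_inj.
  by apply/connect1; rewrite /= /next_entry clineK vlineK.
left; apply: connect_trans pz _; apply/connect1.
by rewrite /= /next_entry clineK.
Qed.

Lemma orbit_exit p0 q : (q \in orbit (next_exit B) p0) ||
  (vline B q \in orbit (next_exit B) p0).
Proof.
apply: (circle_ind (P := fun z => (z \in orbit (next_exit B) p0) ||
  (vline B z \in orbit (next_exit B) p0))) (conn p0 q) _; last first.
- by rewrite -fconnect_orbit connect0.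
- move=> z /orP[]; rewrite -!fconnect_orbit => pz; apply/orP.
    right; apply: connect_trans pz _; rewrite fconnect_sym; last exact: next_exit_inj.
    by apply/connect1; rewrite /= /next_exit vlineK clineK.
  left; apply: connect_trans pz _; apply/connect1.
  by rewrite /= /next_exit vlineK.
by move=> z; rewrite vlineK orbC.
Qed.

Lemma orbit_reading p0 : let o := orbit (next_entry B) p0 in
  fcycle (next_entry B) o /\ perm_eq [seq p.1 | p <- o] (enum {: arrow E}).
Proof.
move=> o; split; first exact: cycle_orbit next_entry_inj _.
apply: uniq_perm; rewrite ?enum_uniq //.
  rewrite map_inj_in_uniq ?orbit_uniq // => p q po qo.
  case/same_arrow=> // qE; move: qo.
  have: fconnect (next_entry B) p q -> False.
    by move/iter_findex; rewrite qE; apply/eqP/entry_no_reversal.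
  move=> /[swap] qo; case; apply: connect_trans (_ : fconnect _ p0 q).
    by rewrite fconnect_sym ?fconnect_orbit //; apply: next_entry_inj.
  by rewrite fconnect_orbit.
move=> a; rewrite mem_enum; apply/mapP.
by have /orP[] := orbit_entry p0 (a, true); [exists (a, true) | exists (a, false)].
Qed.

End Orbit.

Section Laminar.
Variables (E : finType) (B : ribbon_graph E) (o : seq (point E)).
Hypothesis o_cycle : fcycle (next_entry B) o.
Hypothesis o_perm : perm_eq [seq p.1 | p <- o] (enum {: arrow E}).
Hypothesis conn : forall x y, connect (circle_rel B) x y.
Variables (C : E -> {set arrow E}) (T : {set E}).
Hypothesis C_short : forall e, shorter_sequence [seq p.1 | p <- o] e (C e).
Implicit Types (p q x : point E) (a : arrow E) (e f : E).

(* An arrow is represented by the point at which the reading leaves it, so that a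
   half-open arc from one arrow of [f] to the other is exactly a side of [f]. *)
Definition exit_point a : point E :=
  if (a, true) \in o then (a, false) else (a, true).

Lemma exit_pointP a : exit_point a \notin o.
Proof.
rewrite /exit_point; case: ifP => [ao|->//].
by rewrite -(entry_cline o_perm).
Qed.

Lemma exit_point1 a : (exit_point a).1 = a.
Proof. by rewrite /exit_point; case: ifP. Qed.

Lemma exit_pointK p : p \notin o -> exit_point p.1 = p.
Proof.
case: p => a h po; rewrite /exit_point /=.
case: h po => [/negPf->//|]; rewrite -(entry_cline o_perm) /cline /= => -> //.
Qed.

Lemma card_C e : #|C e|.*2 <= #|[set: arrow E]|.
Proof.
have [b [short CE]] := C_short e.
have eb : (e, b) != (e, ~~ b) by rewrite xpair_eqE eqxx; case: (b).
have [u _ _ sizes] := arc_reading o_perm eb.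
by rewrite cardsT -sizes CE cardsE (card_uniqP u) -addnn leq_add2l.
Qed.

Lemma mem_C e : ((e, true) \in C e) = ~~ ((e, false) \in C e).
Proof.
have [b [_ ->]] := C_short e; rewrite !inE.
have eb : (e, b) != (e, ~~ b) by rewrite xpair_eqE eqxx; case: (b).
have [_ + + _] := arc_reading o_perm eb.
by case: b {eb} => /= -> /negPf->.
Qed.

Lemma chords_normal t : chords B T t -> exists s : E -> bool,
  let t' f p := t f p (+) s f in
  chords B T t' /\ forall f a, f \in T -> (a \in C f) = t' f (exit_point a).
Proof.
move=> tT.
have [f|s sP] := @fin_all_exists E (fun=> bool) (fun f s => f \in T ->
    forall p, p \in o -> (p.1 \in C f) = t f (cline p) (+) s).
  have [fT|fT] := boolP (f \in T); last by exists true.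
  have [b [_ CE]] := C_short f.
  have [s sP] := toggle_arc o_cycle o_perm b
    (fun p => chord_v tT p fT) (fun p => chord_c tT p fT).
  by exists s => _ p po; rewrite -sP // CE inE.
exists s; split; last first.
  move=> f a fT; rewrite -[a in LHS]exit_point1 -[exit_point a in RHS]clineK.
  by rewrite -sP // (entry_cline o_perm) exit_pointP.
split=> f p fT; first by rewrite (chord_v tT).
  by rewrite (chord_c tT) // addbAC.
by move=> pT; rewrite (chord_e tT).
Qed.

Variable t : E -> point E -> bool.
Hypothesis tT : chords B T t.
Hypothesis C_t : forall f a, f \in T -> (a \in C f) = t f (exit_point a).

Lemma chord_const g h p q : g \in T -> h \in T -> g != h ->
  edge p = g -> edge q = g -> t h p = t h q.
Proof.
move=> gT hT gh pg qg.
have te r := chord_e tT (p := r) hT; have tc r := chord_c tT r hT.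
have: edge p = edge q by rewrite pg qg.
case/same_edge=> ->.
- by [].
- by rewrite tc pg (negPf gh) addbF.
- by rewrite te ?pg.
by rewrite tc edge_eline te pg // (negPf gh) addbF.
Qed.

Lemma laminar e f : e \in T -> f \in T ->
  [\/ C e \subset C f, C f \subset C e | [disjoint C e & C f]].
Proof.
move=> eT fT; have [->|ef] := eqVneq e f; first by constructor 1.
pose pe : point E := (e, true, true); pose pf : point E := (f, true, true).
(* The circle crosses e on one side of f and f on one side of e, so that one of
   the four combinations of sides does not occur. *)
have corner p : (t e p == t e pf) || (t f p == t f pe).
  apply: (circle_ind (P := fun z => (t e z == t e pf) || (t f z == t f pe)))
    (conn pe p) _; rewrite ?eqxx ?orbT // => z.
    by rewrite !(chord_v tT).
  rewrite !(chord_c tT) //.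
  have [ze|_] := eqVneq (edge z) e.
    rewrite -ze in ef *; rewrite (negPf ef) addbF.
    by rewrite (@chord_const e f z pe) ?eqxx ?orbT // -?ze.
  rewrite addbF; have [zf|_] := eqVneq (edge z) f; last by rewrite addbF.
  by rewrite (@chord_const f e z pf) ?eqxx // eq_sym.
case te: (t e pf) corner; case tf: (t f pe) => corner.
- (* the two shorter sequences cover the circle, hence are its two halves *)
  constructor 3; rewrite -setI_eq0 -cards_eq0 -leqn0.
  have CU : C e :|: C f = [set: arrow E].
    apply/setP=> a; rewrite !inE !C_t //.
    by case: (t e _) (t f _) (corner (exit_point a)) => [] [].
  have := leq_add (card_C e) (card_C f).
  by rewrite -doubleD -cardsUI CU; lia.
- constructor 2; apply/subsetP=> a; rewrite !C_t //.
  by move=> fa; have := corner (exit_point a); rewrite fa orbF => /eqP.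
- constructor 1; apply/subsetP=> a; rewrite !C_t //.
  by move=> ea; have := corner (exit_point a); rewrite ea /= => /eqP.
constructor 3; rewrite disjoint_subset; apply/subsetP=> a.
rewrite !inE !C_t // => ea; have := corner (exit_point a).
by rewrite ea /= => /eqP->.
Qed.

Lemma C_inj e f : e \in T -> f \in T -> C e = C f -> e = f.
Proof.
move=> eT fT CE; apply/eqP; apply: contraT => ef.
have := mem_C e; rewrite CE !C_t //.
suff -> : t f (exit_point (e, true)) = t f (exit_point (e, false)).
  by case: (t f _).
by apply: (chord_const eT fT ef); rewrite /edge exit_point1.
Qed.

Lemma C_orientable e : e \in T -> orientable B [set e].
Proof.
move=> eT; exists (fun p => p \in o); split=> p /=.
- by rewrite (entry_vline o_cycle o_perm); case: (p \in o).
- by rewrite (entry_cline o_perm); case: (p \in o).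
rewrite inE => /eqP pe; apply/eqP.
(* two entries on the same side of e would give two arrows of e in C e *)
suff no_entry q : edge q = e -> q \notin o -> eline q \in o.
  have [po|po] := boolP (p \in o); last by rewrite no_entry.
  have := no_entry (cline p) pe.
  rewrite -cline_eline !(entry_cline o_perm) po => /(_ isT).
  by case: (_ \in o).
move=> qe qo; apply: contraT => eqo.
have := C_t q.1 eT; rewrite exit_pointK //.
have := C_t (eline q).1 eT; rewrite exit_pointK // (chord_e tT) ?qe // => <-.
move: qe; case: (q) => [[e' b] h]; rewrite /edge /eline /flip_arrow /= => ->.
by case: b; rewrite mem_C; case: (_ \in _).
Qed.

Lemma mem_C_other e f b b' : e \in T -> f \in T -> e != f ->
  ((e, b) \in C f) = ((e, b') \in C f).
Proof.
by move=> eT fT ef; rewrite !C_t //; apply: (chord_const eT fT ef);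
  rewrite /edge exit_point1.
Qed.

Lemma mem_C_own e : exists b, ((e, b) \in C e) && ((e, ~~ b) \notin C e).
Proof.
case eC: ((e, true) \in C e); [exists true | exists false].
  by rewrite eC -mem_C.
by rewrite /= -[_ \in C e]negbK -mem_C eC.
Qed.

Lemma own_notin e f b : e \in T -> f \in T -> C f \proper C e -> (e, b) \notin C f.
Proof.
move=> eT fT CfCe; have ef : e != f by apply: contraTneq CfCe => ->; rewrite properxx.
have [c /andP[_ ecC]] := mem_C_own e; apply: contra ecC => ebf.
by apply: (subsetP (proper_sub CfCe)); rewrite (mem_C_other _ b).
Qed.

Lemma C_proper e f : e \in T -> f \in T -> e != f -> C e \subset C f ->
  C e \proper C f.
Proof.
by move=> eT fT ef sub; rewrite properEneq sub andbT; apply: contra ef => /eqP/C_inj->.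
Qed.

Definition region e := C e :\: \bigcup_(f in T | C f \proper C e) C f.

Lemma regionP e a : reflect
  (a \in C e /\ forall f, f \in T -> C f \proper C e -> a \notin C f)
  (a \in region e).
Proof.
rewrite inE andbC; apply: (iffP andP) => -[aC aU]; split=> //.
  by move=> f fT fe; apply: contra aU => af; apply/bigcupP; exists f; rewrite ?fT.
by apply/bigcupP => -[f /andP[fT fe]]; apply/negP/aU.
Qed.

Definition side_class x := [set a | [forall f in T, t f x == t f (exit_point a)]].

Lemma side_classP x a :
  reflect (forall f, f \in T -> t f x = t f (exit_point a)) (a \in side_class x).
Proof.
rewrite inE; apply: (iffP forall_inP) => tx f fT; last by rewrite tx.
exact/eqP/tx.
Qed.

Lemma region_class e : e \in T -> exists x, region e = side_class x.
Proof.
move=> eT; have [b /andP[eb _]] := mem_C_own e.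
exists (exit_point (e, b)); apply/setP=> a.
apply/regionP/side_classP => [[ae a_notin] f fT|tx]; rewrite -?C_t //.
  have [<-|ef] := eqVneq e f; first by rewrite eb ae.
  have [sub|sub|dis] := laminar eT fT.
  - by rewrite !(subsetP sub).
  - have fe : C f \proper C e by apply: C_proper; rewrite // eq_sym.
    by rewrite (negPf (own_notin _ eT fT fe)) (negPf (a_notin f fT fe)).
  by rewrite !(disjointFr dis).
split=> [|f fT fe]; first by rewrite C_t // -tx // -C_t.
by rewrite C_t // -tx // -C_t // own_notin.
Qed.

Lemma outer_class : arrow E ->
  exists x, side_class x = [set a | [forall f in T, a \notin C f]].
Proof.
move=> a0; suff [x0 x0P]: exists x, forall f, f \in T -> t f x = false.
  exists x0; apply/setP=> a; rewrite [RHS]inE.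
  apply/side_classP/forall_inP => tx f fT; first by rewrite C_t // -tx // x0P.
  by rewrite x0P // -C_t // (negPf (tx f fT)).
have [T0|[e0 e0T]] := set_0Vmem T.
  by exists (a0, true) => f; rewrite T0 inE.
case: (arg_maxnP (fun e => #|C e|) e0T) => /= e eT emax.
have [b /andP[eb enb]] := mem_C_own e.
exists (exit_point (e, ~~ b)) => f fT; rewrite -C_t //.
have [<-|ef] := eqVneq e f; first exact: negPf.
apply/negP => enf; have ebf : (e, b) \in C f by rewrite (mem_C_other _ (~~ b)).
have [sub|sub|dis] := laminar eT fT.
- have /proper_card : C e \proper C f by apply: C_proper.
  by rewrite ltnNge emax.
- by rewrite (subsetP sub _ enf) in enb.
by rewrite (disjointFr dis eb) in ebf.
Qed.

Lemma region_count a :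
  \sum_(e in T) (a \in region e) = ~~ [forall f in T, a \notin C f].
Proof.
have [/forall_inP out|] := boolP [forall f in T, a \notin C f].
  rewrite big1 // => e eT; apply/eqP; rewrite eqb0; apply/negP.
  by case/regionP=> ae _; move: (out e eT); rewrite ae.
rewrite negb_forall_in => /exists_inP[e1 e1T]; rewrite negbK => ae1.
pose P e := (e \in T) && (a \in C e).
have e1P : P e1 by rewrite /P e1T.
case: (arg_minnP (fun e => #|C e|) e1P) => /= e /andP[eT ae] emin.
have a_e : a \in region e.
  apply/regionP; split=> // f fT /proper_card; rewrite ltnNge => fe.
  by apply: contra fe => af; apply: emin; rewrite /P fT.
rewrite (bigD1 e) //= a_e big1 // => f /andP[fT fe]; apply/eqP; rewrite eqb0.
apply/negP => /regionP[af a_f]; case/regionP: a_e => _ a_e.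
have [sub|sub|dis] := laminar eT fT.
- have ef : C e \proper C f by apply: C_proper; rewrite // eq_sym.
  by move: (a_f e eT ef); rewrite ae.
- by move: (a_e f fT (C_proper fT eT fe sub)); rewrite af.
by rewrite (disjointFr dis ae) in af.
Qed.

Lemma class_count k : arrow E -> (forall x, #|side_class x| = k) ->
  #|T|.+1 * k = #|{: arrow E}|.
Proof.
move=> a0 card_k; have [x xE] := outer_class a0.
rewrite mulSn -{1}(card_k x) xE -sum_nat_const.
have -> : \sum_(e in T) k = \sum_(e in T) \sum_a (a \in region e : nat).
  apply: eq_bigr => e eT; have [z ->] := region_class eT.
  rewrite -(card_k z) -sum1_card big_mkcond.
  by apply: eq_bigr => a _; case: ifP.
rewrite exchange_big -sum1_card big_mkcond -big_split /= -sum1_card.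
apply: eq_bigr => a _; rewrite region_count inE.
by case: [forall f in T, _].
Qed.

End Laminar.

Section Vertices.
Variable E : finType.
Implicit Types (H B : ribbon_graph E) (T : {set E}) (a : arrow E).

Lemma card_vertex H a h :
  #|[set q | connect (circle_rel H) (a, h) q]| = (degree H a).*2.
Proof.
rewrite -muln2 -card_bool -[in RHS]cardsT -cardsX; apply: eq_card => -[b h'].
rewrite !inE andbT /same_circle.
have flip c k k' : connect (circle_rel H) (c, k) (c, k').
  case: k k' => [] []; rewrite ?connect0 //.
    exact: (circle_cline H (c, true)).
  exact: (circle_cline H (c, false)).
apply/idP/idP => ab; apply: connect_trans (flip _ _ _) _.
  exact: connect_trans ab (flip _ _ _).
exact: connect_trans ab (flip _ _ _).
Qed.

Lemma card_side_class H B T side theta theta' o s k x :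
  cuts H T side -> dual_map H B T theta theta' ->
  fcycle (next_entry B) o -> perm_eq [seq p.1 | p <- o] (enum {: arrow E}) ->
  (forall x y, connect (connect_rel H T) x y) ->
  (forall p, #|[set q | connect (circle_rel H) p q]| = k.*2) ->
  #|side_class o T (fun f p => side f (theta p) (+) s f) x| = k.
Proof.
move=> cutT D o_cycle o_perm conn card_k.
pose V := [set z | connect (circle_rel H) (theta x) (theta z)].
have Vv z : (vline B z \in V) = (z \in V).
  rewrite !inE -(dual_v D); apply/idP/idP => xz; apply: connect_trans xz _.
    by rewrite circle_connect_sym circle_vline.
  exact: circle_vline.
have cardV : #|V| = k.*2.
  rewrite -(card_k (theta x)) -(card_imset _ (can_inj (dualK D))).
  apply: eq_card => z; rewrite !inE; apply/imsetP/idP => [[y + ->]|xz].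
    by rewrite inE.
  by exists (theta' z); rewrite ?inE (dualK' D).
pose O := [set p in o].
have cardO : #|V :&: O| = #|V :\: O|.
  rewrite -[RHS](card_imset _ (@vline_inj _ B)); apply: eq_card => z.
  rewrite !inE; apply/andP/imsetP => [[zV zo]|[y + ->]].
    exists (vline B z); last by rewrite vlineK.
    by rewrite in_setD Vv !inE zV (entry_vline o_cycle o_perm) zo.
  by rewrite in_setD -Vv !inE (entry_vline o_cycle o_perm) => /andP[].
have -> : #|side_class o T (fun f p => side f (theta p) (+) s f) x| = #|V :\: O|.
  have exit_inj : injective (exit_point o).
    by move=> a b ab; rewrite -(exit_point1 o a) ab exit_point1.
  rewrite -(card_imset _ exit_inj); apply: eq_card => z.
  apply/imsetP/setDP => [[a /side_classP tx ->]|[zV zo]].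
    split; last by rewrite inE exit_pointP.
    rewrite inE; apply: (cuts_vertex cutT) (conn _ _) _ => f fT.
    exact: addIb (tx f fT).
  rewrite inE in zo; exists z.1; last by rewrite exit_pointK.
  apply/side_classP => f fT; rewrite exit_pointK //; congr (_ (+) _).
  by apply: (cuts_circle cutT) => //; rewrite inE in zV.
by move: cardV; rewrite -(cardsID O) cardO addnn => /double_inj.
Qed.

End Vertices.

Section Contraction.
Variables (E : finType) (H : ribbon_graph E) (T : {set E}).
Variable side : E -> point E -> bool.
Hypothesis cutT : cuts H T side.

Let B := pdual T H.
Hypothesis conn : forall x y, connect (circle_rel B) x y.

Lemma pdual_old_out (p : point E) : edge p \notin T -> pdual_old T p = p.
Proof. by rewrite /pdual_old => /negPf->. Qed.

Lemma adjoint_set_tree f g : g \in T -> (g \in adjoint_set H T f) = (g == f).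
Proof. by move=> gT; rewrite !inE gT orbF. Qed.

Lemma adjoint_setE f g : f \in T -> g \notin T -> (g \in adjoint_set H T f) =
  side f (g, false, true) (+) side f (g, true, false).
Proof.
move=> fT gT; have gf : g != f by apply: contraNneq gT => ->.
rewrite !inE gT (negPf gf) /= -/B.
have [o_cycle o_perm] := orbit_reading conn ((f, false), false).
set o := orbit _ _ in o_cycle o_perm *.
have tT := dual_map_chords (dual_map_pdual T H) cutT.
have [s sP] := toggle_arc o_cycle o_perm false
  (fun p => chord_v tT p fT) (fun p => chord_c tT p fT).
have arcE b h : ((g, b) \in arc [seq p.1 | p <- o] (f, false) (f, true)) =
    side f (g, b, h) (+) s.
  have sc q : edge q = g -> side f (pdual_old T (cline q)) = side f q.
    by move=> qg; rewrite pdual_old_out ?edge_cline ?qg // (cut_c cutT).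
  have side_h h' : side f (g, b, h') = side f (g, b, h).
    by case: h h' => [] []; rewrite // -[LHS](cut_c cutT).
  have := sP (cline (exit_point o (g, b))).
  rewrite (entry_cline o_perm) exit_pointP // => /(_ isT).
  rewrite /= exit_point1 /= => ->; rewrite clineK; congr (_ (+) _).
  rewrite pdual_old_out /edge ?exit_point1 //.
  by case: (exit_point o (g, b)) (exit_point1 o (g, b)) => a h' /= ->.
by rewrite (arcE false true) (arcE true false) addbACA addbb addbF.
Qed.

Lemma tindexE (D : {set E}) (chi : point E -> bool) e :
  (forall p, chi (vline B p) = chi p) ->
  (forall p, chi (cline p) = chi p (+) (edge p \in D)) ->
  tindex B D e = chi (e, false, true) (+) chi (e, true, false).
Proof.
move=> chi_v chi_c; rewrite /tindex /nb_vlines.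
set p : point E := (e, false, true); set q : point E := (e, true, false).
set o := orbit _ _; set P := fun r => (r == q) || _; set i := find P o.
have oE : o = p :: behead o by rewrite /o /orbit -orderSpred.
have o_path : fpath (next_exit B) p (behead o).
  by rewrite /o /orbit -orderSpred /=; apply: fpath_traject.
have walk l x j : fpath (next_exit B) x l -> j <= size l ->
    chi (nth p (x :: l) j) =
    chi x (+) odd (count (fun r => edge r \in D) (take j l)).
  elim: l x j => [|y l IH] x [|j] //=; rewrite ?addbF //.
  case/andP=> /eqP xy yl jl; rewrite IH // oddD oddb -xy.
  by rewrite {1}/next_exit chi_c chi_v addbA.
have has_q : has P o.
  have /orP[qo|qo] := orbit_exit conn p q; apply/hasP.
    by exists q; rewrite // /P /= eqxx.
  by exists (vline B q); rewrite // /P; apply/orP; right; rewrite vlineK.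
have i_lt : i < size o by rewrite -has_find.
have chi_q : chi (nth p o i) = chi q.
  by have /orP[] := nth_find p has_q => /eqP <-.
rewrite /= -chi_q {2}oE walk //; last by rewrite oE in i_lt.
by rewrite addbA addbb addFb; case: odd.
Qed.

End Contraction.

Section Renamings.
Variable E : finType.
Implicit Types (G H : ribbon_graph E) (A D : {set E}) (p : point E).

Lemma petrial_pointE A e b h :
  petrial_point A (e, b, h) = (e, b, h (+) ((e \in A) && b)).
Proof.
by rewrite /petrial_point /edge /cline /=; case: (_ && _); rewrite ?addbT ?addbF.
Qed.

Lemma pdual_oldE A e b h :
  pdual_old A (e, b, h) = (e, b (+) ((e \in A) && h), h (+) (e \in A)).
Proof.
rewrite /pdual_old /edge /flip_arrow /=.
by case: (e \in A); case: h; rewrite ?addbT ?addbF.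
Qed.

Lemma pdual_newE A e b h :
  pdual_new A (e, b, h) = (e, b (+) ((e \in A) && ~~ h), h (+) (e \in A)).
Proof.
rewrite /pdual_new /edge /flip_arrow /=.
by case: (e \in A); case: h; rewrite ?addbT ?addbF.
Qed.

Lemma petrial_point_cline A p :
  petrial_point A (cline p) = cline (petrial_point A p).
Proof.
by case: p => [[e b] h]; rewrite /cline /= !petrial_pointE addNb.
Qed.

Lemma petrial_point_eline A p : petrial_point A (eline p) =
  if edge p \in A then cline (eline (petrial_point A p))
  else eline (petrial_point A p).
Proof.
case: p => [[e b] h]; rewrite /cline /eline /flip_arrow /= !petrial_pointE /edge.
by case: (e \in A) b h => [] [] [].
Qed.

Lemma twisted_dual_normal G H : twisted_dual G H ->
  exists A1 A2 A3,
    same_ribbon_graph H (petrial A3 (pdual A2 (petrial A1 G))).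
Proof.
case=> [A1 [A2 [A3 [A4 [A5 [A6 [cov dis [bareE [s [r srP]]]]]]]]]].
exists (A3 :|: A4 :|: A6), (A2 :|: A4 :|: A5 :|: A6), (A5 :|: A6).
split=> //; exists s, r => p; rewrite -srP.
have cov_e e : [|| e \in A1, e \in A2, e \in A3, e \in A4, e \in A5 | e \in A6].
  by have /setP/(_ e) := cov; rewrite !inE -!orbA.
have dis_e e : pairwise (fun x y => ~~ (x && y))
    [seq e \in (A : {set E}) | A <- [:: A1; A2; A3; A4; A5; A6]].
  rewrite pairwise_map; apply: sub_pairwise dis => X Y /= XY.
  by apply/andP => -[eX]; rewrite (disjointFr XY eX).
have old_eq q : petrial_point (A3 :|: A4 :|: A6)
      (pdual_old (A2 :|: A4 :|: A5 :|: A6) (petrial_point (A5 :|: A6) q)) =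
    pdual_old A2 (petrial_point A3 (petrial_point A4 (pdual_old A4
      (pdual_old A5 (petrial_point A5 (petrial_point A6 (pdual_old A6
        (petrial_point A6 q)))))))).
  case: q => [[e b] h]; rewrite !(petrial_pointE, pdual_oldE, pdual_newE) !inE.
  move: (cov_e e) (dis_e e) => /=.
  by case: (e \in A1) (e \in A2) (e \in A3) (e \in A4) (e \in A5) (e \in A6) =>
    [] [] [] [] [] [] // _ _; case: b h => [] [].
have new_eq q : petrial_point (A5 :|: A6)
      (pdual_new (A2 :|: A4 :|: A5 :|: A6) (petrial_point (A3 :|: A4 :|: A6) q)) =
    petrial_point A6 (pdual_new A6 (petrial_point A6 (petrial_point A5
      (pdual_new A5 (pdual_new A4 (petrial_point A4 (petrial_point A3
        (pdual_new A2 q)))))))).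
  case: q => [[e b] h]; rewrite !(petrial_pointE, pdual_oldE, pdual_newE) !inE.
  move: (cov_e e) (dis_e e) => /=.
  by case: (e \in A1) (e \in A2) (e \in A3) (e \in A4) (e \in A5) (e \in A6) =>
    [] [] [] [] [] [] // _ _; case: b h => [] [].
by rewrite /= new_eq old_eq.
Qed.

Lemma connected_rename (e0 : E) (f g : point E -> point E) (fK : cancel f g)
    (gK : cancel g f) H :
  (forall p, edge (g p) = edge p) -> connected H -> connected (rename fK gK H).
Proof.
move=> edge_g /(connected_onP e0)[conn bare0].
apply/(connected_onP e0); split=> // x y; rewrite -(fK x) -(fK y).
apply: (connect_rel_ind (P := fun z => connect (connect_rel _ _) (g (f x)) (g z)))
  (conn (f x) (f y)) (connect0 _ _) => [z xz|z xz|z _ xz]; apply: connect_trans xz _.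
- by apply: connect1; rewrite /connect_rel /circle_rel /= gK eqxx.
- by apply: connect_edge; rewrite ?inE // !edge_g.
by apply: connect_edge; rewrite ?inE // !edge_g.
Qed.

Lemma edge_petrial_point A p : edge (petrial_point A p) = edge p.
Proof. by rewrite /petrial_point; case: ifP. Qed.

Lemma petrial_transport A H K s r : (forall p, vline (petrial A K) (relabel s r p)
      = relabel s r (vline H p)) ->
  exists rho rho' : point E -> point E,
    [/\ cancel rho rho', cancel rho' rho,
        forall p, vline K (rho p) = rho (vline H p),
        forall p, rho (cline p) = cline (rho p) &
        forall p, edge (rho p) = edge p /\
          rho (eline p) = if edge p \in A then cline (eline (rho p))
                          else eline (rho p)].
Proof.
move=> srP; have relabelK : involutive (relabel s r).
  by move=> [[e b] h]; rewrite /relabel /edge /= -!addbA !addbb !addbF.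
exists (fun p => petrial_point A (relabel s r p)).
exists (fun p => relabel s r (petrial_point A p)); split=> p.
- by rewrite petrial_pointK relabelK.
- by rewrite relabelK petrial_pointK.
- by rewrite -srP /= petrial_pointK.
- rewrite -petrial_point_cline; congr petrial_point.
  by case: p => [[e b] h]; rewrite /relabel /cline /edge /= addNb.
split; first by rewrite edge_petrial_point.
have -> : relabel s r (eline p) = eline (relabel s r p).
  by case: p => [[e b] h]; rewrite /relabel /eline /flip_arrow /edge /= !addNb.
by rewrite petrial_point_eline.
Qed.

End Renamings.

Lemma in_bigsymdiff (E I : finType) (P : pred I) (F : I -> {set E}) x :
  (x \in \big[@symdiff E/set0]_(i | P i) F i) =
  \big[addb/false]_(i | P i) (x \in F i).
Proof.
by apply: (big_morph (fun A : {set E} => x \in A)) => [A B|];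
  rewrite ?in_symdiff ?inE.
Qed.

Lemma ribbon_edge (E : finType) k (G H : ribbon_graph E) :
  connected G -> bare H = bare G -> 0 < k -> regular k H -> inhabited E.
Proof.
move=> Gconn bareE k_gt0 [_ k0]; have [e0 _|E0] := pickP (fun _ : E => true).
  exact: inhabits e0.
move: Gconn; rewrite /connected /connected_on /nb_components /n_comp_mem.
rewrite eq_card0 => [|[[e b] h]].
  by rewrite add0n -bareE => /eqP bare1; rewrite k0 ?bare1 in k_gt0.
by have := E0 e.
Qed.

Theorem theorem5p3 (E : finType) (G : ribbon_graph E) (m k : nat)
    (C : ribbon_graph E -> E -> {set E * bool})
    (hC : forall B : ribbon_graph E, bouquet B -> shorter_sequences B (C B))
    (hG : connected G) (hm : #|E| = m) (hk0 : 0 < k) (hk : ~~ odd k)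
    (H : ribbon_graph E) (hGH : twisted_dual G H)
    (hreg : regular k H) (hcc : checkerboard_colourable H) :
  exists A1 A2 A3 : {set E},
    [/\ same_ribbon_graph H (petrial A3 (pdual A2 (petrial A1 G))),
        exists Q S : {set E},
          let B := pdual Q (petrial A1 G) in
          [/\ quasi_tree (petrial A1 G) Q,
              A2 = symdiff Q S,
              #|S|.+1 * k = 2 * m,
              shorter_sequence_set B (C B) S &
              forall e, e \in S -> seq_degree (C B) S e = k] &
        exists T : {set E},
          let H1 := pdual A2 (petrial A1 G) in
          spanning_tree H1 T /\
          A3 = symdiff (tindex1_set H1 T)
                 (\big[@symdiff E/set0]_(f in A3 :&: T) adjoint_set H1 T f)].
Proof.
have [A1 [A2 [A3 HN]]] := twisted_dual_normal hGH.
have [bareE [s [r srP]]] := HN.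
have [e0] := ribbon_edge hG bareE hk0 hreg.
set K := petrial A1 G in HN srP *; set H1 := pdual A2 K in HN srP *.
have K_conn : connected K.
  exact: (connected_rename e0 _ _ (edge_petrial_point A1) hG).
have H1_conn : connected H1.
  exact: (connected_rename e0 _ _ (edge_pdual_new A2) K_conn).
have [T [side [T_conn cutT]]] := connected_cuts e0 H1_conn.
have [conn bare0] := connected_onP e0 H1 T T_conn.
have T_quasi : quasi_tree H1 T.
  apply/(quasi_treeP e0); split=> // x y; exact: cuts_boundary cutT _ _ conn.
have [rho [rho' [rhoK rhoK' rho_v rho_c rho_e]]] := petrial_transport srP.
exists A1, A2, A3; split=> //.
  pose Q := symdiff A2 T; pose B := pdual Q K.
  have D := dual_map_pdual2 A2 T K.
  have B_bouquet : bouquet B by rewrite (dual_map_bouquet e0 D).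
  have card_k p : #|[set q | connect (circle_rel H1) p q]| = k.*2.
    have rel x y : circle_rel H1 (rho x) (rho y) = circle_rel H x y.
      by rewrite /circle_rel rho_v -rho_c !(can_eq rhoK).
    have := card_vertex H (rho' p).1 (rho' p).2.
    rewrite -surjective_pairing hreg.1 => <-.
    rewrite -[RHS](card_imset _ (can_inj rhoK)); apply: eq_card => z.
    rewrite inE -{1}(rhoK' p) -{1}(rhoK' z) (connect_bij rhoK rhoK' rel).
    apply/idP/imsetP => [pz|[y]]; first by exists (rho' z); rewrite ?inE.
    by rewrite inE => + ->; rewrite rhoK.
  have [B_conn _] := bouquetP e0 B B_bouquet.
  have [w [o o_cycle [wE o_perm]] short] := hC B B_bouquet.
  rewrite {w}wE in o_perm short.
  have [s' [/= chT CP]] := chords_normal o_cycle o_perm short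
    (dual_map_chords D cutT).
  have class_k x := card_side_class s' x cutT D o_cycle o_perm conn card_k.
  exists Q, T; split.
  - by rewrite -(dual_map_bouquet e0 (dual_map_pdual Q K)).
  - by apply/setP=> x; rewrite !in_symdiff -addbA addbb addbF.
  - rewrite (class_count o_cycle o_perm B_conn short chT CP (e0, true) class_k).
    by rewrite card_prod card_bool hm mulnC.
  - split=> [e eT|e f eT fT].
      exact (C_orientable o_cycle o_perm short chT CP eT).
    exact (laminar o_cycle o_perm B_conn short chT CP eT fT).
  move=> e eT; rewrite -/B -[seq_degree _ _ _]/#|region (C B) T e|.
  have [x ->] := region_class o_cycle o_perm B_conn short chT CP eT.
  exact: class_k.
exists T; split; first by split=> //; apply: cuts_acyclic cutT.
have B1_conn : forall x y, connect (circle_rel (pdual T H1)) x y.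
  apply: (bouquetP e0 _ _).1.
  by rewrite (dual_map_bouquet e0 (dual_map_pdual T H1)).
have [c [c_conn c_c]] := hcc.
pose chi p := c (rho' p).
have chiE p : chi (rho p) = c p by rewrite /chi rhoK.
have chi_v p : chi (vline H1 p) = chi p.
  rewrite -(rhoK' p) rho_v !chiE; apply/esym/c_conn/connect1.
  by rewrite /boundary_rel eqxx.
have chi_c p : chi (cline p) = ~~ chi p.
  rewrite -(rhoK' p) -rho_c !chiE.
  by case: (c _) (c _) (c_c (rho' p)) => [] [].
have chi_e p : chi (eline p) = chi p (+) (edge p \in A3).
  have c_e q : c (eline q) = c q.
    by apply/esym/c_conn/connect1; rewrite /boundary_rel inE eqxx orbT.
  have [edge_rho rho_eq] := rho_e (rho' p).
  have := chiE (eline (rho' p)); rewrite c_e rho_eq -edge_rho -chiE rhoK'.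
  by case: ifP => _ <-; rewrite ?chi_c ?addbT ?negbK ?addbF.
pose F := A3 :&: T.
pose chi' p := chi (pdual_old T p) (+)
  \big[addb/false]_(f in F) side f (pdual_old T p).
have D := dual_map_pdual T H1.
have F_T f : f \in F -> f \in T by rewrite inE => /andP[].
have big_eq e : \big[addb/false]_(f in F) (e == f) = (e \in F).
  have [eF|eF] := boolP (e \in F).
    rewrite (bigD1 e) //= eqxx big1 // => f /andP[_ /negPf].
    by rewrite eq_sym.
  by rewrite big1 // => f fF; apply: contraNF eF => /eqP->.
have chi'_v p : chi' (vline (pdual T H1) p) = chi' p.
  rewrite /chi' -(dual_v D) chi_v; congr (_ (+) _).
  by apply: eq_bigr => f /F_T fT; rewrite (cut_v cutT).
have chi'_c p : chi' (cline p) = chi' p (+) (edge p \in ~: T).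
  rewrite /chi' (dual_c D) inE; have [pT|pT] := boolP (edge p \in T).
    rewrite chi_e (dual_edge D) addbF.
    rewrite (eq_bigr (fun f => side f (pdual_old T p) (+) (edge p == f)));
      last by move=> f /F_T fT; rewrite (cut_e cutT) ?(dual_edge D).
    by rewrite big_split /= big_eq inE pT andbT addbACA addbb addbF.
  rewrite chi_c addbT addNb; congr (~~ (_ (+) _)).
  by apply: eq_bigr => f /F_T fT; rewrite (cut_c cutT).
apply/setP=> e; rewrite in_symdiff in_bigsymdiff inE -/F.
have [eT|eT] /= := boolP (e \in T).
  rewrite (eq_bigr (fun f => e == f)) => [|f _]; last exact: adjoint_set_tree.
  by rewrite big_eq inE eT andbT.
rewrite /contraction_tindex (tindexE B1_conn _ chi'_v chi'_c) eqb1.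
rewrite (eq_bigr (fun f => side f (e, false, true) (+) side f (e, true, false)));
  last by move=> f /F_T fT; rewrite (adjoint_setE cutT B1_conn).
rewrite big_split /= /chi' !pdual_old_out // (addbACA (chi _)) -addbA addbb addbF.
by rewrite [chi (e, true, false)](chi_e (e, false, true)) addbA addbb.
Qed.
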